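(* Let $G:\mathbb{R}^n\to\mathbb{R}^n$ be nonexpansive, i.e. $\|G(\mathbf{u})-G(\mathbf{v})\|\le\|\mathbf{u}-\mathbf{v}\|$ for all $\mathbf{u},\mathbf{v}\in\mathbb{R}^n$, and suppose that $G$ has a fixed point $\mathbf{u}^*$. Let $m\ge 1$ be an integer, $\lambda\in(0,1)$, $\mathbf{u}_0\in\mathbb{R}^n$, and let $\Theta:[0,1]\to[0,1)$ be a non-decreasing function with $\Theta(0)=0$ and $\Theta(t)>0$ for every $t>0$. Let $\{\mathbf{u}_k\}$ be the (infinite) sequence generated by the algorithm GlobAA($m$), where the parameters $\{\gamma_k\}$ satisfy, for all $k\ge 0$, $$0<\gamma_k<1\quad\text{and}\quad\gamma_k\le 1-\Theta(W_k/W_0),\qquad W_k:=\max_{0\le j\le m_k}\|F_{k-m_k+j}\|.$$ Then $\|F(\mathbf{u}_k)\|\to 0$ as $k\to\infty$.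
   Context: $\|\cdot\|$ is the Euclidean norm on $\mathbb{R}^n$. For $G:\mathbb{R}^n\to\mathbb{R}^n$ the residual mapping is $F(\mathbf{u}):=G(\mathbf{u})-\mathbf{u}$. Algorithm GlobAA($m$). Inputs: $\mathbf{u}_0\in\mathbb{R}^n$, a positive integer $m$, a relaxation parameter $\lambda$ (here $\lambda\in(0,1)$), and a rule for choosing $\gamma_k\in(0,1)$. Initialize $k=0$, $\kappa=0$. While $\|F(\mathbf{u}_k)\|>0$, do the following. (1) Set $m_k=\min\{m,k-\kappa\}$, $G_k=G(\mathbf{u}_k)$, $F_k=G_k-\mathbf{u}_k$, and choose $\gamma_k$. (2) Let $(\alpha_0^k,\dots,\alpha_{m_k}^k)$ be a solution of $\min\big\|\sum_{j=0}^{m_k}\alpha_jF_{k-m_k+j}\big\|$ subject to $\sum_{j=0}^{m_k}\alpha_j=1$, and set $\mathbf{u}_{\rm AA}^{k+1}=\sum_{j=0}^{m_k}\alpha_j^kG_{k-m_k+j}$. (3) If $\|F(\mathbf{u}_{\rm AA}^{k+1})\|\le\gamma_k\max_{0\le j\le m_k}\|F_{k-m_k+j}\|$ (acceptance condition), set $\mathbf{u}_{k+1}=\mathbf{u}_{\rm AA}^{k+1}$ (Anderson step, $\kappa$ unchanged); otherwise set $\mathbf{u}_{k+1}=(1-\lambda)\mathbf{u}_k+\lambda G_k$ and reset $\kappa=k+1$ (Krasnosel'skii–Mann step). (4) Replace $k$ by $k+1$. The condition on $\gamma_k$ is meaningful because $W_k\le W_0$ for all $k\ge 0$, so $W_k/W_0\in[0,1]$.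 Standing assumption: the algorithm never stops, i.e. $F(\mathbf{u}_k)\ne 0$ for all $k\ge 0$, so that an infinite sequence is generated. *)

(* Defs.v *)
From HB Require Import structures.
From mathcomp Require Import all_boot all_order all_algebra.
From mathcomp Require Import all_classical all_reals all_analysis.

Set Implicit Arguments.
Unset Strict Implicit.
Unset Printing Implicit Defensive.

Import Order.TTheory GRing.Theory Num.Theory.

Local Open Scope ring_scope.

(* The library norm on matrices is the sup norm, hence this definition. *)
Definition euclidean_norm (R : realType) (n : nat) (x : 'cV[R]_n) : R :=
  Num.sqrt (\sum_(i < n) x i 0 ^+ 2).

Definition nonexpansive (R : realType) (n : nat) (G : 'cV[R]_n -> 'cV[R]_n) :
    Prop :=
  forall x y, euclidean_norm (G x - G y) <= euclidean_norm (x - y).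

Definition residual (R : realType) (n : nat) (G : 'cV[R]_n -> 'cV[R]_n)
  (x : 'cV[R]_n) : 'cV[R]_n := G x - x.

(* [alpha] is a (not necessarily unique) solution of the constrained
   least-squares problem for the vectors [f 0, ..., f p]. *)
Definition anderson_weights (R : realType) (n p : nat)
    (f : 'I_p.+1 -> 'cV[R]_n) (alpha : 'I_p.+1 -> R) : Prop :=
  \sum_j alpha j = 1 /\
  forall beta : 'I_p.+1 -> R, \sum_j beta j = 1 ->
    euclidean_norm (\sum_j alpha j *: f j) <=
    euclidean_norm (\sum_j beta j *: f j).

(* The depth m_k; [kappa k] is the value of the restart index at the beginning
   of iteration k.  Since m_k <= k, the truncated subtraction in [window]
   is exact. *)
Definition depth (m : nat) (kappa : nat -> nat) (k : nat) : nat :=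
  minn m (k - kappa k).

Definition window (m : nat) (kappa : nat -> nat) (k : nat)
  (j : 'I_(depth m kappa k).+1) : nat := (k - depth m kappa k + j)%N.

(* W_k; the default value 0 of the maximum is harmless, the window being
   nonempty and norms being nonnegative. *)
Definition max_residual (R : realType) (n : nat) (G : 'cV[R]_n -> 'cV[R]_n)
    (m : nat) (u : nat -> 'cV[R]_n) (kappa : nat -> nat) (k : nat) : R :=
  \big[Num.max/0]_(j < (depth m kappa k).+1)
    euclidean_norm (residual G (u (window j))).

Definition anderson_iterate (R : realType) (n : nat)
    (G : 'cV[R]_n -> 'cV[R]_n) (m : nat) (u : nat -> 'cV[R]_n)
    (kappa : nat -> nat) (k : nat) (alpha : 'I_(depth m kappa k).+1 -> R) :
    'cV[R]_n :=
  \sum_j alpha j *: G (u (window j)).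

(* An infinite run of GlobAA(m): every residual is nonzero, so the loop never
   exits.  [alpha k] are the weights used at iteration k; the rule choosing the
   parameters [gamma k] is represented by the values it produces. *)
Record globAA_run (R : realType) (n : nat) (G : 'cV[R]_n -> 'cV[R]_n)
    (m : nat) (lambda : R) (u0 : 'cV[R]_n) (gamma : nat -> R)
    (u : nat -> 'cV[R]_n) (kappa : nat -> nat)
    (alpha : forall k, 'I_(depth m kappa k).+1 -> R) : Prop := GlobAARun {
  globAA_init : u 0%N = u0 /\ kappa 0%N = 0%N ;
  globAA_continue : forall k, residual G (u k) != 0 ;
  globAA_weights : forall k,
    anderson_weights (fun j => residual G (u (window j))) (alpha k) ;
  globAA_step : forall k,
    let uAA := anderson_iterate G u (alpha k) in
    (u k.+1, kappa k.+1) =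
      if euclidean_norm (residual G uAA)
           <= gamma k * max_residual G m u kappa k
      then (uAA, kappa k)
      else ((1 - lambda) *: u k + lambda *: G (u k), k.+1)
}.

(* Main.v *)
Require Import Defs.
From mathcomp Require Import all_boot all_order all_algebra.
From mathcomp Require Import all_classical all_reals all_analysis.
From mathcomp Require Import zify ring lra.

Set Implicit Arguments.
Unset Strict Implicit.
Unset Printing Implicit Defensive.

Import Order.TTheory GRing.Theory Num.Theory numFieldNormedType.Exports.

Local Open Scope classical_set_scope.
Local Open Scope ring_scope.

(** In one step of the algorithm the residual norm cannot grow beyond
    [W_k], the largest residual norm in the window, so [W_k] is nonincreasing,
    and it is enough to rule out that [W_k >= eps > 0] for all [k].

    In that case monotonicity of [Theta] bounds every [gamma_k] by the constant
    [q = 1 - Theta (eps / W_0) < 1].  Call step [k] contracting if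
    [|F_(k+1)| <= q W_k]; every Anderson step is contracting.  A contracting
    step is never undone: later Krasnosel'skii-Mann steps do not increase the
    residual, and later Anderson steps produce residuals of norm at most
    [q W_i <= q W_k].  Hence [|F_i| <= q W_k] for all [i > k], and once the
    window has moved past [k], [W_(k+m+1) <= q W_k]
    ([max_residual_contracting]).

    - If contracting steps recur forever, this contradicts the positivity of
      [inf_k W_k] ([contracting_finite]).
    - Otherwise all steps are eventually Krasnosel'skii-Mann steps.  Each of
      them lowers the squared distance to a fixed point by at least
      [lambda (1 - lambda) |F_k|^2] ([km_sqr_dist_le]), and then
      [eps <= W_(k+m) <= |F_k|] because residuals no longer grow, so that
      distance would become negative ([km_tail_false]). *)

(** * Squared Euclidean norms *)

Lemma euclidean_norm_ge0 (R : realType) (n : nat) (x : 'cV[R]_n) :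
  0 <= euclidean_norm x.
Proof. exact: sqrtr_ge0. Qed.

Lemma sqr_euclidean_norm (R : realType) (n : nat) (x : 'cV[R]_n) :
  euclidean_norm x ^+ 2 = \sum_(i < n) x i 0 ^+ 2.
Proof. by rewrite sqr_sqrtr // sumr_ge0 // => i _; rewrite sqr_ge0. Qed.

Lemma ler_euclidean_norm (R : realType) (n p : nat)
    (x : 'cV[R]_n) (y : 'cV[R]_p) :
  (euclidean_norm x <= euclidean_norm y) =
  (euclidean_norm x ^+ 2 <= euclidean_norm y ^+ 2).
Proof. by rewrite ler_sqr // nnegrE euclidean_norm_ge0. Qed.

Lemma sqr_euclidean_normZ (R : realType) (n : nat) (a : R) (x : 'cV[R]_n) :
  euclidean_norm (a *: x) ^+ 2 = a ^+ 2 * euclidean_norm x ^+ 2.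
Proof.
rewrite !sqr_euclidean_norm mulr_sumr; apply: eq_bigr => i _.
by rewrite mxE exprMn.
Qed.

(** The last term gives the decrease of the distance to fixed points; being
    nonpositive, it also makes the squared norm convex, which is the form of
    the triangle inequality used below. *)
Lemma sqr_euclidean_norm_conv (R : realType) (n : nat) (t : R)
    (x y : 'cV[R]_n) :
  euclidean_norm ((1 - t) *: x + t *: y) ^+ 2 =
  (1 - t) * euclidean_norm x ^+ 2 + t * euclidean_norm y ^+ 2
  - t * (1 - t) * euclidean_norm (y - x) ^+ 2.
Proof.
rewrite !sqr_euclidean_norm !mulr_sumr -big_split -sumrB; apply: eq_bigr => i _.
by rewrite !mxE /=; ring.
Qed.

(** * The Krasnosel'skii-Mann step *)

(** With [x'] the new point, [F x' = (1 - t) F x + t y] where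
    [t y = G x' - G x]; nonexpansiveness gives [|y| <= |F x|] because
    [x' - x = t F x], so [|F x'| <= |F x|] by convexity. *)
Lemma km_residual_le (R : realType) (n : nat) (G : 'cV[R]_n -> 'cV[R]_n)
    (t : R) (x : 'cV[R]_n) :
  nonexpansive G -> 0 < t < 1 ->
  euclidean_norm (residual G ((1 - t) *: x + t *: G x)) <=
  euclidean_norm (residual G x).
Proof.
move=> Gne /andP[t0 t1]; set x' := _ + _; rewrite ler_euclidean_norm.
pose y := t^-1 *: (G x' - G x).
have tN0 : t != 0 by rewrite gt_eqF.
have -> : residual G x' = (1 - t) *: residual G x + t *: y.
  apply/matrixP => i j; rewrite /y scalerA mulfV // scale1r /residual /x' !mxE.
  by ring.
have ley : euclidean_norm y ^+ 2 <= euclidean_norm (residual G x) ^+ 2.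
  have := Gne x' x; rewrite ler_euclidean_norm.
  have -> : x' - x = t *: residual G x.
    by apply/matrixP => i j; rewrite /residual /x' !mxE; ring.
  rewrite !sqr_euclidean_normZ exprVn => le.
  by rewrite ler_pdivrMl // exprn_gt0.
rewrite sqr_euclidean_norm_conv.
have := sqr_ge0 (euclidean_norm (y - residual G x)).
move: ley; set A := _ ^+ 2; set B := _ ^+ 2; set C := _ ^+ 2 => BA C0.
have : 0 <= t * (1 - t) * C by apply: mulr_ge0 => //; apply: mulr_ge0; lra.
have : t * A <= t * B by rewrite ler_pM2l.
by lra.
Qed.

Lemma km_sqr_dist_le (R : realType) (n : nat) (G : 'cV[R]_n -> 'cV[R]_n)
    (t : R) (x z : 'cV[R]_n) :
  nonexpansive G -> 0 < t < 1 -> G z = z ->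
  euclidean_norm ((1 - t) *: x + t *: G x - z) ^+ 2 <=
  euclidean_norm (x - z) ^+ 2
  - t * (1 - t) * euclidean_norm (residual G x) ^+ 2.
Proof.
move=> Gne /andP[t0 t1] Gz.
have -> : (1 - t) *: x + t *: G x - z = (1 - t) *: (x - z) + t *: (G x - z).
  by apply/matrixP => i j; rewrite !mxE; ring.
rewrite sqr_euclidean_norm_conv.
have -> : G x - z - (x - z) = residual G x.
  by apply/matrixP => i j; rewrite !mxE; ring.
have := Gne x z; rewrite Gz ler_euclidean_norm => le.
have : t * euclidean_norm (G x - z) ^+ 2 <= t * euclidean_norm (x - z) ^+ 2.
  by rewrite ler_pM2l.
by lra.
Qed.

(** * The windowed maximum of residual norms *)

Local Notation residual_norm G u k := (euclidean_norm (residual G (u k))).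

Lemma residual_norm_le_max (R : realType) (n : nat) (G : 'cV[R]_n -> 'cV[R]_n)
    (m : nat) (u : nat -> 'cV[R]_n) (kappa : nat -> nat) (k i : nat) :
  (k - depth m kappa k <= i <= k)%N ->
  residual_norm G u i <= max_residual G m u kappa k.
Proof.
move=> /andP[lei ile].
have ltj : (i - (k - depth m kappa k) < (depth m kappa k).+1)%N by lia.
have := le_bigmax_cond 0 (fun j : 'I_(depth m kappa k).+1 =>
  euclidean_norm (residual G (u (window j)))) (isT : xpredT (Ordinal ltj)).
by rewrite {1}/window /= subnKC.
Qed.

Lemma max_residual_ge0 (R : realType) (n : nat) (G : 'cV[R]_n -> 'cV[R]_n)
    (m : nat) (u : nat -> 'cV[R]_n) (kappa : nat -> nat) (k : nat) :
  0 <= max_residual G m u kappa k.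
Proof.
apply: le_trans (euclidean_norm_ge0 (residual G (u k))) _.
by apply: residual_norm_le_max; rewrite leq_subr leqnn.
Qed.

Lemma max_residual_le (R : realType) (n : nat) (G : 'cV[R]_n -> 'cV[R]_n)
    (m : nat) (u : nat -> 'cV[R]_n) (kappa : nat -> nat) (k : nat) (M : R) :
  (forall i, (k - depth m kappa k <= i <= k)%N -> residual_norm G u i <= M) ->
  max_residual G m u kappa k <= M.
Proof.
move=> leM; apply: bigmax_le => [|j _].
  apply: le_trans (leM k _); first exact: euclidean_norm_ge0.
  by rewrite leq_subr leqnn.
apply: leM; rewrite /window leq_addr /=.
have := ltn_ord j; have : (depth m kappa k <= k)%N by rewrite /depth; lia.
by lia.
Qed.

(** The window has length at most [m], so a bound on the residuals from index
    [k] on takes over the maximum after [m] steps. *)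
Lemma max_residual_tail_le (R : realType) (n : nat)
    (G : 'cV[R]_n -> 'cV[R]_n) (m : nat) (u : nat -> 'cV[R]_n)
    (kappa : nat -> nat) (k : nat) (M : R) :
  (forall i, (k <= i)%N -> residual_norm G u i <= M) ->
  max_residual G m u kappa (k + m) <= M.
Proof.
move=> leM; apply: max_residual_le => i /andP[lei _]; apply: leM.
have : (depth m kappa (k + m) <= m)%N by rewrite geq_minl.
by lia.
Qed.

(** * Runs of the algorithm *)

Lemma globAA_step_cases (R : realType) (n : nat) (G : 'cV[R]_n -> 'cV[R]_n)
    (m : nat) (lambda : R) (u0 : 'cV[R]_n) (gamma : nat -> R)
    (u : nat -> 'cV[R]_n) (kappa : nat -> nat)
    (alpha : forall k, 'I_(depth m kappa k).+1 -> R) (k : nat) :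
  globAA_run G lambda u0 gamma u alpha ->
  residual_norm G u k.+1 <= gamma k * max_residual G m u kappa k /\
    kappa k.+1 = kappa k \/
  u k.+1 = (1 - lambda) *: u k + lambda *: G (u k) /\ kappa k.+1 = k.+1.
Proof.
move=> run; have /= := globAA_step run k.
by case: ifP => [acc|_] [-> ->]; [left | right].
Qed.

(** The left end of the window never moves back, and the one index that enters
    carries a residual of norm at most [W_k]. *)
Lemma max_residual_nonincreasing (R : realType) (n : nat)
    (G : 'cV[R]_n -> 'cV[R]_n) (m : nat) (lambda : R) (u0 : 'cV[R]_n)
    (gamma : nat -> R) (u : nat -> 'cV[R]_n) (kappa : nat -> nat)
    (alpha : forall k, 'I_(depth m kappa k).+1 -> R) :
  nonexpansive G -> 0 < lambda < 1 ->
  globAA_run G lambda u0 gamma u alpha -> (forall k, gamma k <= 1) ->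
  {homo max_residual G m u kappa : i j / (i <= j)%N >-> j <= i}.
Proof.
move=> Gne lam run gam1.
apply: homo_leq => [x|y x z xy yz|k]; [exact: lexx | exact: le_trans yz xy |].
apply: max_residual_le => i /andP[lei]; rewrite leq_eqVlt => /predU1P[->|ile].
  have [[le _]|[-> _]] := globAA_step_cases k run.
    by apply: le_trans le _; rewrite ler_piMl // max_residual_ge0.
  apply: le_trans (km_residual_le _ Gne lam) _.
  by apply: residual_norm_le_max; rewrite leq_subr leqnn.
apply: residual_norm_le_max; move: lei; rewrite /depth.
by have [[_ ->]|[_ ->]] := globAA_step_cases k run; lia.
Qed.

(** The bound [q * W_k] holds for all later residuals: Krasnosel'skii-Mann steps
    preserve it, and an Anderson step at [i > k] gives at most
    [gamma_i * W_i <= q * W_k].  So it does not matter whether a restart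
    happens before the window has moved past [k]. *)
Lemma max_residual_contracting (R : realType) (n : nat)
    (G : 'cV[R]_n -> 'cV[R]_n) (m : nat) (lambda : R) (u0 : 'cV[R]_n)
    (gamma : nat -> R) (u : nat -> 'cV[R]_n) (kappa : nat -> nat)
    (alpha : forall k, 'I_(depth m kappa k).+1 -> R) (q : R) (k : nat) :
  nonexpansive G -> 0 < lambda < 1 ->
  globAA_run G lambda u0 gamma u alpha ->
  0 <= q <= 1 -> (forall k, gamma k <= q) ->
  residual_norm G u k.+1 <= q * max_residual G m u kappa k ->
  max_residual G m u kappa (k.+1 + m) <= q * max_residual G m u kappa k.
Proof.
move=> Gne lam run /andP[q0 q1] gamq contr; apply: max_residual_tail_le.
have gam1 i : gamma i <= 1 by exact: le_trans (gamq i) q1.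
move=> i /subnKC <-; elim: (i - _)%N => [|p IH]; first by rewrite addn0.
rewrite addnS; set j := (k.+1 + p)%N in IH *.
have [[le _]|[-> _]] := globAA_step_cases j run.
  apply: le_trans le _; apply: le_trans (ler_wpM2r _ (gamq j)) _.
    exact: max_residual_ge0.
  rewrite ler_wpM2l // (max_residual_nonincreasing Gne lam run gam1) //.
  by rewrite /j; lia.
by apply: le_trans IH; exact: km_residual_le.
Qed.

(** For [k] large, [W k] is below [c / q] with [c = inf W > 0]; a contracting
    step there would give [W (k + p) < c]. *)
Lemma contracting_finite (R : realType) (W : nat -> R) (p : nat) (q eps : R)
    (contracting : nat -> Prop) :
  {homo W : i j / (i <= j)%N >-> j <= i} ->
  0 < eps -> (forall k, eps <= W k) -> 0 < q < 1 ->
  (forall k, contracting k -> W (k + p)%N <= q * W k) ->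
  exists K, forall k, (K <= k)%N -> ~ contracting k.
Proof.
move=> Wle eps0 epsW /andP[q0 q1] contr.
have hasinf : has_inf (range W).
  by split; [exists (W 0%N), 0%N | exists eps => _ [k _ <-]].
pose c := inf (range W).
have cW k : c <= W k by apply: ge_inf; [exact: hasinf.2 | exists k].
have c0 : 0 < c.
  apply: lt_le_trans eps0 _; apply: lb_le_inf; first exact: hasinf.1.
  by move=> _ [k _ <-].
have [_ [K _ <-] ltK] : exists2 w, range W w & w < c / q.
  by apply: inf_lt; [exact: hasinf.1 | rewrite ltr_pdivlMr // gtr_pMr].
exists K => k leKk /contr; apply/negP; rewrite -ltNge.
apply: lt_le_trans (cW _); rewrite mulrC -ltr_pdivlMr //.
exact: le_lt_trans (Wle _ _ leKk) ltK.
Qed.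

(** Each step from [K] on lowers the squared distance to [z] by at least
    [t (1 - t) eps ^ 2], which cannot go on forever. *)
Lemma km_tail_false (R : realType) (n : nat) (G : 'cV[R]_n -> 'cV[R]_n)
    (t eps : R) (z : 'cV[R]_n) (u : nat -> 'cV[R]_n) (K : nat) :
  nonexpansive G -> 0 < t < 1 -> G z = z -> 0 < eps ->
  (forall k, (K <= k)%N -> u k.+1 = (1 - t) *: u k + t *: G (u k)) ->
  (forall k, (K <= k)%N -> eps <= residual_norm G u k) -> False.
Proof.
move=> Gne t01 Gz eps0 km epsF.
pose D k := euclidean_norm (u k - z) ^+ 2.
pose d := t * (1 - t) * eps ^+ 2.
have d0 : 0 < d.
  by case/andP: t01 => ? ?; rewrite !mulr_gt0 ?subr_gt0.
have decr p : D (K + p)%N <= D K - p%:R * d.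
  elim: p => [|p IH]; first by rewrite addn0 mul0r subr0.
  have := km_sqr_dist_le (u (K + p)%N) Gne t01 Gz.
  rewrite -km ?leq_addr // -addnS -/(D (K + p.+1)%N) -/(D (K + p)%N).
  have : d <= t * (1 - t) * residual_norm G u (K + p)%N ^+ 2.
    rewrite /d ler_pM2l.
      by rewrite ler_sqr ?nnegrE ?euclidean_norm_ge0 ?epsF ?leq_addr // ltW.
    by case/andP: t01 => ? ?; rewrite mulr_gt0 ?subr_gt0.
  by rewrite -natr1 mulrDl mul1r; lra.
have := decr (Num.bound (D K / d)).
have DK0 : 0 <= D K / d by rewrite divr_ge0 ?sqr_ge0 // ltW.
have := archi_boundP DK0; rewrite ltr_pdivrMr // => lt le.
have := sqr_ge0 (euclidean_norm (u (K + Num.bound (D K / d))%N - z)).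
by rewrite -/(D _); lra.
Qed.

Theorem theorem2p15 (R : realType) (n : nat) (G : 'cV[R]_n -> 'cV[R]_n)
    (G_nonexp : nonexpansive G)
    (G_fix : exists ustar : 'cV[R]_n, G ustar = ustar)
    (m : nat) (m_ge1 : (1 <= m)%N)
    (lambda : R) (lambda01 : 0 < lambda < 1)
    (u0 : 'cV[R]_n)
    (Theta : R -> R)
    (Theta_range : forall t : R, 0 <= t <= 1 -> 0 <= Theta t < 1)
    (Theta_nondecr : forall s t : R, 0 <= s -> s <= t -> t <= 1 ->
      Theta s <= Theta t)
    (Theta0 : Theta 0 = 0)
    (Theta_gt0 : forall t : R, 0 < t <= 1 -> 0 < Theta t)
    (gamma : nat -> R) (u : nat -> 'cV[R]_n) (kappa : nat -> nat)
    (alpha : forall k, 'I_(depth m kappa k).+1 -> R)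
    (run : globAA_run G lambda u0 gamma u alpha)
    (gamma01 : forall k, 0 < gamma k < 1)
    (gamma_le : forall k, gamma k <=
      1 - Theta (max_residual G m u kappa k / max_residual G m u kappa 0)) :
  (fun k => euclidean_norm (residual G (u k))) @ \oo --> 0.
Proof.
have [ustar Gustar] := G_fix.
pose F k := residual_norm G u k; pose W := max_residual G m u kappa.
have gam1 k : gamma k <= 1 by case/andP: (gamma01 k) => _ /ltW.
have Wle : {homo W : i j / (i <= j)%N >-> j <= i}.
  exact: (max_residual_nonincreasing G_nonexp lambda01 run gam1).
have FW k : F k <= W k by apply: residual_norm_le_max; rewrite leq_subr leqnn.
suff Wsmall eps : 0 < eps -> exists N, W N < eps.
  apply/cvgrPdist_lt => eps /Wsmall[N ltN]; exists N => // k /= leNk.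
  rewrite sub0r normrN ger0_norm ?euclidean_norm_ge0 //.
  exact: le_lt_trans (le_trans (FW k) (Wle _ _ leNk)) ltN.
move=> eps0; apply: contrapT => nW.
have epsW k : eps <= W k by rewrite leNgt; apply/negP => lt; apply: nW; exists k.
have W0 : 0 < W 0%N := lt_le_trans eps0 (epsW 0%N).
have ratio01 : 0 < eps / W 0%N <= 1.
  by rewrite divr_gt0 //= ler_pdivrMr // mul1r.
pose q := 1 - Theta (eps / W 0%N).
have gamq k : gamma k <= q.
  apply: le_trans (gamma_le k) _; rewrite lerD2l lerN2.
  apply: Theta_nondecr; first by case/andP: ratio01 => /ltW.
    by rewrite ler_pM2r ?invr_gt0 // epsW.
  by rewrite ler_pdivrMr // mul1r; exact: Wle.
have q01 : 0 < q < 1.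
  apply/andP; split; last by rewrite gtrBl Theta_gt0.
  by apply: lt_le_trans (gamq 0%N); case/andP: (gamma01 0%N).
have q01w : 0 <= q <= 1 by case/andP: q01 => /ltW -> /ltW ->.
have [K noncontr] : exists K, forall k, (K <= k)%N -> ~ (F k.+1 <= q * W k).
  apply: (@contracting_finite _ W m.+1 q eps) => // k contr.
  rewrite addnS -addSn.
  exact: max_residual_contracting G_nonexp lambda01 run q01w gamq contr.
have km k : (K <= k)%N -> u k.+1 = (1 - lambda) *: u k + lambda *: G (u k).
  move=> /noncontr ncontr.
  have [[le _]|[-> //]] := globAA_step_cases k run.
  by case: ncontr; apply: le_trans le _; rewrite ler_wpM2r // max_residual_ge0.
apply: (km_tail_false G_nonexp lambda01 Gustar eps0 km) => k leKk.
(* Krasnosel'skii-Mann steps do not increase residuals, so the maximum over the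
   window is at most [F k] after [m] of them. *)
apply: le_trans (epsW (k + m)%N) _; apply: max_residual_tail_le => i.
move=> /subnKC <-; elim: (i - k)%N => [|p IH]; first by rewrite addn0.
rewrite addnS km; last exact: leq_trans leKk (leq_addr _ _).
exact: le_trans (km_residual_le _ G_nonexp lambda01) IH.
Qed.
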